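(* Let $m > 1$ be an integer with $m \equiv 2, 3, 5$ or $6 \pmod 9$. Let $N$ be any term of the sequence $A352991$ that is a permutation of $A007908(m)$, i.e. $N$ is the positive integer whose decimal representation is obtained by concatenating the decimal representations of $\sigma(1), \sigma(2), \ldots, \sigma(m)$ for some permutation $\sigma$ of $\{1, 2, \ldots, m\}$. Then $N$ is not a perfect power of an integer, i.e. there are no positive integer $a$ and integer $k \geq 2$ with $N = a^k$.
   Context: For a positive integer $m$, $A007908(m)$ is the positive integer whose decimal representation is the concatenation, in this order, of the decimal representations of $1, 2, 3, \ldots, m$. The sequence $A352991$ consists, sorted in ascending order, of all positive integers obtained, for some $m \geq 1$, by concatenating the decimal representations of $1, 2, \ldots, m$ in some order (whole numbers are permuted, not individual digits: $12345671089$ is a term, $12345670189$ is not). A positive integer $d$ is a perfect power if $d = a^k$ for some positive integer $a$ and some integer $k \geq 2$. *)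

(* Defs.v *)
From mathcomp Require Import all_boot all_fingroup.

Set Implicit Arguments.
Unset Strict Implicit.
Unset Printing Implicit Defensive.

(* Most significant digit first, without leading zeros for n > 0:
   [trunc_log 10 n] is the exponent of the leading power of 10. *)
Definition decimal (n : nat) : seq nat :=
  [seq (n %/ 10 ^ i) %% 10 | i <- rev (iota 0 (trunc_log 10 n).+1)].

Definition decimal_value (ds : seq nat) : nat :=
  foldl (fun v d => 10 * v + d) 0 ds.

Definition decimal_concat (s : seq nat) : nat :=
  decimal_value (flatten [seq decimal n | n <- s]).

(* N is a term of A352991 that is a permutation of A007908(m). The element
   i : 'I_m stands for the integer i + 1, so that s ranges over the
   permutations of {1, ..., m}. *)
Definition A352991_term (m N : nat) : Prop :=
  exists s : 'S_m, N = decimal_concat [seq (s i).+1 | i <- enum 'I_m].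

Definition perfect_power (d : nat) : Prop :=
  exists a k : nat, [/\ 0 < a, 2 <= k & d = a ^ k].

(* Main.v *)
Require Import Defs.
From mathcomp Require Import all_boot all_fingroup.
From mathcomp Require Import zify.

(** Casting out nines, N is congruent to 1 + 2 + ... + m = m (m + 1) / 2
    modulo 9, which is 3 or 6 for the given residues of m. Hence 3 divides N
    but 9 does not, whereas a perfect power divisible by 3 is divisible by 9. *)

Lemma decimal_value_mod9 (ds : seq nat) : decimal_value ds = sumn ds %[mod 9].
Proof.
suff foldlE v : foldl (fun v d => 10 * v + d) v ds = v + sumn ds %[mod 9].
  exact: foldlE.
elim: ds v => [|d ds IHds] v /=; first by rewrite addn0.
by rewrite IHds; lia.
Qed.

(** Induction on [k] strips the last digit: [n] is [10 * (n %/ 10) + n %% 10], and 10 is 1 modulo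
    9. *)
Lemma sum_digits_mod9 (k n : nat) :
  n < 10 ^ k -> \sum_(i < k) (n %/ 10 ^ i) %% 10 = n %[mod 9].
Proof.
elim: k n => [|k IHk] n ltn; first by rewrite big_ord0; case: n ltn.
rewrite big_ord_recl expn0 divn1.
under eq_bigr => i _ do rewrite /= expnS divnMA.
have ltq : n %/ 10 < 10 ^ k by rewrite ltn_divLR // mulnC -expnS.
by rewrite -modnDmr IHk // modnDmr; lia.
Qed.

Lemma sumn_decimal_mod9 (n : nat) : sumn (decimal n) = n %[mod 9].
Proof.
(* Digit order does not affect the sum; [subn0] gives the [iota] the shape of an [index_iota]. *)
rewrite /decimal map_rev sumn_rev sumnE big_map -[_.+1]subn0.
by rewrite -/(index_iota _ _) big_mkord sum_digits_mod9 // trunc_log_ltn.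
Qed.

Lemma decimal_concat_mod9 (s : seq nat) : decimal_concat s = sumn s %[mod 9].
Proof.
rewrite /decimal_concat decimal_value_mod9.
elim: s => //= n s IHs.
by rewrite sumn_cat -modnDm sumn_decimal_mod9 IHs modnDm.
Qed.

Lemma sumn_perm_ord (m : nat) (s : 'S_m) :
  sumn [seq (s i).+1 | i <- enum 'I_m] = 'C(m.+1, 2).
Proof.
rewrite sumnE big_map big_enum.
rewrite -(reindex_inj (P := xpredT) (F := fun i : 'I_m => i.+1) (@perm_inj _ s)).
(* [bin2_sum] sums from 0 to [m]; its zero term is split off. *)
by rewrite -bin2_sum big_mkord big_ord_recl.
Qed.

(** A prime dividing [a ^ k] divides [a], so its square divides [a ^ 2], hence [a ^ k]. *)
Lemma perfect_power_dvd_sqr (p N : nat) :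
  prime p -> perfect_power N -> p %| N -> p ^ 2 %| N.
Proof.
move=> p_pr [a [k [_ k_ge2 ->]]]; rewrite Euclid_dvdX // => /andP[p_dv_a _].
exact: dvdn_trans (dvdn_exp2r 2 p_dv_a) (dvdn_exp2l a k_ge2).
Qed.

Theorem theorem2p1 (m : nat) (hm : 1 < m)
  (hmod : [\/ m = 2 %[mod 9], m = 3 %[mod 9], m = 5 %[mod 9] | m = 6 %[mod 9]])
  (N : nat) (hN : A352991_term m N) : ~ perfect_power N.
Proof.
case: hN => s N_eq /(@perfect_power_dvd_sqr 3 N isT).
have N_mod9 : N = 'C(m.+1, 2) %[mod 9].
  by rewrite N_eq decimal_concat_mod9 sumn_perm_ord.
(* Doubling clears the division by 2 in the binomial and, 2 being invertible modulo 9, preserves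
   divisibility by 3 and by 9. *)
have twoN : N * 2 = m.+1 * m %[mod 9].
  rewrite -modnMml N_mod9 modnMml.
  by rewrite -[2 in LHS]/(2`!) bin_ffact ffactnS ffactn1.
have : N * 2 %% 9 = 6 \/ N * 2 %% 9 = 3.
  rewrite twoN -modnMm -addn1 -[(m + 1) %% 9]modnDml.
  by case: hmod => ->; [left | right | right | left].
by rewrite -[3 ^ 2]/9; lia.
Qed.
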